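(* Let $\mu$ be a positive Borel measure on the real line, $\{P_n\}_{n=0}^{\infty}$ the associated sequence of monic orthogonal polynomials, and $\mathcal{L}^{(M)}=\sum_{k=0}^{M}\rho_k(x)\frac{d^k}{dx^k}$ an exactly solvable operator with $\rho_k(x)=\sum_{j=0}^{k}\rho_{k,j}x^j$. Then there exists a unique sequence of monic polynomials $\{Q_n\}_{n=0}^{\infty}$, with each $Q_n$ of degree equal to $n$ and orthogonal with respect to $(\mathcal{L}^{(M)},\mu)$, if and only if any one of the following (mutually equivalent) statements holds: i) $\deg\mathcal{L}^{(M)}[x^n]=n$ for all $n\ge0$; ii) for every $n\in\mathbb{Z}_+$ there exists a unique monic polynomial $\widehat Q_n$ such that $\mathcal{L}^{(M)}[\widehat Q_n]=\lambda_nP_n$; iii) $\ker\mathcal{L}^{(M)}=\{0\}$ (on the space of polynomials); iv) $\lambda_n\neq0$ for all $n\ge0$.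
   Context: An exactly solvable operator of order $M$ is $\mathcal{L}^{(M)}=\sum_{k=0}^{M}\rho_k(x)\frac{d^k}{dx^k}$ with complex polynomials $\rho_k$, $\deg\rho_k\le k$ for all $k$, equality for at least one $k$, and $\rho_M\not\equiv0$. $\lambda_n=\sum_{k=0}^{M}\rho_{k,k}\frac{n!}{(n-k)!}$ is the coefficient of $x^n$ in $\mathcal{L}^{(M)}[x^n]$, with the convention $\frac{n!}{(n-k)!}=0$ for $k>n$. The measure $\mu$ is finite, has finite moments of all orders and infinite support. $Q_n$ is orthogonal with respect to $(\mathcal{L}^{(M)},\mu)$ (for the index $n$) if $\deg Q_n\le n$ and $\int\mathcal{L}^{(M)}[Q_n](x)P(x)\,d\mu(x)=0$ for every polynomial $P$ with $\deg P\le n-1$. *)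

(* Defs.v *)
From HB Require Import structures.
From mathcomp Require Import all_boot all_order all_algebra.
From mathcomp Require Import complex.
From mathcomp Require Import all_classical all_reals all_analysis.

Set Implicit Arguments.
Unset Strict Implicit.
Unset Printing Implicit Defensive.

Import Order.TTheory GRing.Theory Num.Theory.
Import numFieldNormedType.Exports.

Local Open Scope classical_set_scope.
Local Open Scope ring_scope.
Local Open Scope complex_scope.

(* MathComp-Analysis integrates real-valued functions only. *)
Definition Cintegral (R : realType)
    (mu : {measure set (measurableTypeR R) -> \bar R}) (f : R -> R[i]) : R[i] :=
  (\int[mu]_x complex.Re (f x))%R +i* (\int[mu]_x complex.Im (f x))%R.

Definition measure_support (R : realType)
    (mu : {measure set (measurableTypeR R) -> \bar R}) : set R :=
  [set x | forall U : set R, open U -> U x -> (0 < mu U)%E].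

Definition finite_moments (R : realType)
    (mu : {measure set (measurableTypeR R) -> \bar R}) : Prop :=
  forall k : nat, mu.-integrable setT (fun x : R => (x ^+ k)%:E).

Definition monic_OPS (R : realType)
    (mu : {measure set (measurableTypeR R) -> \bar R})
    (P : nat -> {poly R}) : Prop :=
  (forall n, P n \is monic /\ size (P n) = n.+1) /\
  (forall m n, m != n -> (\int[mu]_x (P m * P n).[x])%R = 0).

Definition diffop (F : nzRingType) (M : nat) (rho : 'I_M.+1 -> {poly F})
    (q : {poly F}) : {poly F} :=
  \sum_(k < M.+1) rho k * q^`(k).

Definition exactly_solvable (F : nzRingType) (M : nat)
    (rho : 'I_M.+1 -> {poly F}) : Prop :=
  [/\ forall k : 'I_M.+1, (size (rho k) <= k.+1)%N,
      exists k : 'I_M.+1, size (rho k) = k.+1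
    & rho ord_max != 0].

(* The falling factorial n ^_ k is n! / (n - k)!, and is 0 for k > n. *)
Definition lambda (F : nzRingType) (M : nat) (rho : 'I_M.+1 -> {poly F})
    (n : nat) : F :=
  \sum_(k < M.+1) (rho k)`_k * (n ^_ k)%:R.

(* [size q <= n] encodes deg q <= n - 1; for n = 0 it leaves only q = 0. *)
Definition diffop_orthogonal (R : realType) (M : nat)
    (rho : 'I_M.+1 -> {poly R[i]})
    (mu : {measure set (measurableTypeR R) -> \bar R})
    (n : nat) (Q : {poly R[i]}) : Prop :=
  (size Q <= n.+1)%N /\
  (forall q : {poly R[i]}, (size q <= n)%N ->
     Cintegral mu (fun x => (diffop rho Q).[x%:C] * q.[x%:C]) = 0).

(* Main.v *)
Require Import Defs.
From HB Require Import structures.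
From mathcomp Require Import all_boot all_order all_algebra.
From mathcomp Require Import complex finmap zify.
From mathcomp Require Import all_classical all_reals all_analysis.

Set Implicit Arguments.
Unset Strict Implicit.
Unset Printing Implicit Defensive.

Import Order.TTheory GRing.Theory Num.Theory.
Import numFieldNormedType.Exports.

Local Open Scope classical_set_scope.
Local Open Scope ring_scope.
Local Open Scope complex_scope.


(** Why the theorem holds.  Write L for the operator [diffop rho].  The degree
bound on the coefficients makes L upper triangular in the monomial basis: it
maps polynomials of degree at most n to themselves, and the coefficient of X^n
in L p is lambda_n p_n ([coef_diffop]).  Hence L is bijective on each of these
spaces when no lambda_n vanishes ([diffop_solvable], [diffop_eq0]), whereas at
the first m with lambda_m = 0 the polynomial L X^m has degree below m, where L
is still onto, and correcting X^m gives a monic K with L K = 0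
([monic_kernel]).  This settles the equivalence of (i), (iii) and (iv).

Orthogonality of Q_n says that L Q_n is orthogonal to all polynomials of lower
degree, and the only such polynomials of degree at most n are the multiples of
P_n ([Cintegral_orthogonalP]).  Comparing the coefficients of X^n, it says
that L Q_n = lambda_n P_n ([diffop_orthogonalE]), an equation that is purely
algebraic.  If no lambda_n vanishes, it has exactly one solution.  If some
lambda_m vanishes, then K can be added to any solution of degree larger than
deg K: the sequence is then not unique.

Statement (ii) does not prescribe the degree of its solutions.  To refute it
in the same way, an index n > deg K with lambda_n != 0 is needed: a solution
Q then has degree at least n, as L does not raise degrees, and Q + K is again
monic.  Such an n exists because lambda_n is a polynomial in n, and a nonzero
one as some rho_k has degree exactly k ([lambda_neq0_above]).

The analytic input is the expansion in the orthogonal polynomials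
([OPS_orthogonal]) and the definiteness of the inner product: a real polynomial
whose square has zero integral vanishes on the support of the measure, which
is infinite ([integral_horner_sqr_eq0]).  Complex polynomials are reduced to
real ones through their real and imaginary parts. *)

(** * Triangular action of the operator on polynomials *)

(** Adding a monic kernel element of smaller degree to a monic solution is how
every uniqueness claim is refuted when some lambda_n vanishes. *)
Lemma monic_perturb (F : nzRingType) (Q K : {poly F}) :
    Q \is monic -> K \is monic -> (size K < size Q)%N ->
  [/\ Q + K \is monic, size (Q + K) = size Q & Q + K <> Q].
Proof.
move=> /monicP lcQ K_monic ltKQ.
rewrite monicE lead_coefDl // lcQ eqxx size_polyDl //; split=> //.
move=> /eqP; rewrite -subr_eq0 addrC addKr => /eqP K0.
by move: K_monic; rewrite K0 monicE lead_coef0 eq_sym oner_eq0.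
Qed.

Section TriangularOperator.
Variables (F : fieldType) (M : nat) (rho : 'I_M.+1 -> {poly F}).

Lemma diffop_is_linear : linear (diffop rho).
Proof.
move=> a p q; rewrite /diffop scaler_sumr -big_split /=.
by apply: eq_bigr => k _; rewrite derivnD derivnZ mulrDr scalerAr.
Qed.

HB.instance Definition _ :=
  GRing.isLinear.Build F {poly F} {poly F} _ (diffop rho) diffop_is_linear.

Hypothesis size_rho : forall k : 'I_M.+1, (size (rho k) <= k.+1)%N.

(** In the convolution for (rho_k p^(k))_n, the terms rho_{k,i} with i > k
vanish by the degree of rho_k, those with i < k by the degree of p; what
remains is the diagonal entry. *)
Lemma coef_diffop (p : {poly F}) n :
  (size p <= n.+1)%N -> (diffop rho p)`_n = lambda rho n * p`_n.
Proof.
move=> /leq_sizeP p_small; rewrite /diffop coef_sum /lambda mulr_suml.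
apply: eq_bigr => k _; rewrite coefM.
have vanish (i : 'I_n.+1) : (i : nat) != k -> (rho k)`_i * p^`(k)`_(n - i) = 0.
  move=> ne_ik; have [lt_ki|le_ik] := ltnP k i.
    by have /leq_sizeP-> := size_rho k; rewrite ?mul0r.
  rewrite coef_derivn p_small ?mul0rn ?mulr0 //.
  have lt_ik : (i < k)%N by rewrite ltn_neqAle ne_ik.
  by have := ltn_ord i; lia.
have [le_kn|lt_nk] := leqP k n; last first.
  rewrite big1 => [|i _]; first by rewrite ffact_small // mulr0 mul0r.
  by apply: vanish; have := ltn_ord i; lia.
have lt_kn1 : (k < n.+1)%N by [].
rewrite (bigD1 (Ordinal lt_kn1)) //= [X in _ + X]big1 => [|i ne_ik]; last first.
  by apply: vanish; move: ne_ik; rewrite -val_eqE.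
by rewrite addr0 coef_derivn subnKC // -mulrA mulr_natl.
Qed.

Lemma size_diffop (p : {poly F}) : (size (diffop rho p) <= size p)%N.
Proof.
apply/leq_sizeP => j le_pj.
by rewrite coef_diffop ?(leqW le_pj) // nth_default ?mulr0.
Qed.

Lemma size_diffopXn n :
  (size (diffop rho 'X^n) == n.+1) = (lambda rho n != 0).
Proof.
have szL : (size (diffop rho 'X^n) <= n.+1)%N.
  by rewrite (leq_trans (size_diffop _)) ?size_polyXn.
have coefL : (diffop rho 'X^n)`_n = lambda rho n.
  by rewrite coef_diffop ?size_polyXn // coefXn eqxx mulr1.
apply/eqP/idP => [szLn|lam0].
  rewrite -coefL -[n in _`_n]/(n.+1.-1) -szLn lead_coef_eq0.
  by rewrite -size_poly_eq0 szLn.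
apply/eqP; rewrite eqn_leq szL ltnNge.
by apply: contra lam0 => /leq_sizeP Ln0; rewrite -coefL Ln0.
Qed.

(** Back substitution: the leading coefficient is matched first, using
lambda_m, and the remainder has smaller degree.  Only the diagonal entries
below m matter, which is what [monic_kernel] relies on. *)
Lemma diffop_solvable m (r : {poly F}) :
    (forall j, (j < m)%N -> lambda rho j != 0) -> (size r <= m)%N ->
  exists2 q : {poly F}, (size q <= m)%N & diffop rho q = r.
Proof.
elim: m r => [|m IHm] r lam_neq0 szr.
  exists 0; first by rewrite size_poly0.
  by rewrite raddf0; apply/esym/eqP; rewrite -size_poly_leq0.
have szXm (c : F) : (size (c *: 'X^m) <= m.+1)%N.
  by rewrite (leq_trans (size_scale_leq _ _)) ?size_polyXn.
pose t := (r`_m / lambda rho m) *: 'X^m.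
have szrt : (size (r - diffop rho t)%R <= m)%N.
  apply/leq_sizeP => j; rewrite leq_eqVlt => /predU1P[<-|lt_mj].
    rewrite coefB coef_diffop ?szXm // coefZ coefXn eqxx mulr1 mulrC.
    by rewrite divfK ?subrr ?lam_neq0.
  rewrite nth_default // (leq_trans _ lt_mj) //.
  rewrite (leq_trans (size_polyD _ _)) // geq_max szr size_polyN.
  exact: leq_trans (size_diffop _) (szXm _).
have [q szq Lq] := IHm _ (fun j lt_jm => lam_neq0 j (ltnW lt_jm)) szrt.
exists (q + t); last by rewrite linearD /= Lq subrK.
by rewrite (leq_trans (size_polyD _ _)) // geq_max szXm (leq_trans szq).
Qed.

(** The leading coefficient of p is multiplied by a nonzero diagonal entry. *)
Lemma diffop_eq0 :
  (forall n, lambda rho n != 0) -> forall p, diffop rho p = 0 -> p = 0.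
Proof.
move=> lam_neq0 p Lp0; apply/eqP; apply: contraT => p_neq0.
have szp : (size p <= (size p).-1.+1)%N by rewrite leqSpred.
have /eqP := coef_diffop szp; rewrite Lp0 coef0 eq_sym mulf_eq0.
rewrite (negPf (lam_neq0 _)) -[_`_ _]/(lead_coef p) lead_coef_eq0.
by rewrite (negPf p_neq0).
Qed.

(** At the first vanishing lambda_m, L X^m has degree below m, where L is onto:
if L q = L X^m with deg q < m, then X^m - q is in the kernel. *)
Lemma monic_kernel n :
    lambda rho n = 0 ->
  exists2 K : {poly F}, K \is monic & diffop rho K = 0.
Proof.
move=> lam_n0.
have ex_lam0 : exists n, lambda rho n == 0 by exists n; apply/eqP.
case: (ex_minnP ex_lam0) => m /eqP lam_m0 m_min.
have lam_lt j : (j < m)%N -> lambda rho j != 0.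
  by rewrite ltnNge; apply: contra => /m_min.
have szLXm : (size (diffop rho 'X^m) <= m)%N.
  apply/leq_sizeP => j; rewrite leq_eqVlt => /predU1P[<-|lt_mj].
    by rewrite coef_diffop ?size_polyXn // lam_m0 mul0r.
  by rewrite nth_default // (leq_trans (size_diffop _)) ?size_polyXn.
have [q szq Lq] := diffop_solvable lam_lt szLXm.
exists ('X^m - q); last by rewrite linearB /= Lq subrr.
apply/monicP; rewrite lead_coefDl ?lead_coefXn //.
by rewrite size_polyN size_polyXn ltnS.
Qed.

(** The factor lambda_n on the right is what makes the solution monic. *)
Lemma monic_diffop_solution n (r : {poly F}) :
    (forall j, lambda rho j != 0) -> r \is monic -> size r = n.+1 ->
  exists q : {poly F},
    [/\ q \is monic, size q = n.+1 & diffop rho q = lambda rho n *: r].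
Proof.
move=> lam_neq0 r_monic szr.
have szlr : (size (lambda rho n *: r) <= n.+1)%N.
  by rewrite (leq_trans (size_scale_leq _ _)) ?szr.
have [q szq Lq] := diffop_solvable (fun j _ => lam_neq0 j) szlr.
have qn1 : q`_n = 1.
  apply: (mulfI (lam_neq0 n)); rewrite -coef_diffop // Lq coefZ.
  by move/monicP: r_monic; rewrite /lead_coef szr => ->.
have szqn : size q = n.+1.
  apply/eqP; rewrite eqn_leq szq ltnNge; apply/negP => /leq_sizeP qn0.
  by move/eqP: qn1; rewrite qn0 // eq_sym oner_eq0.
by exists q; split=> //; rewrite monicE /lead_coef szqn qn1.
Qed.

End TriangularOperator.

(** * The eigenvalues as a polynomial in the degree *)

Section EigenvaluePolynomial.
Variables (F : numFieldType) (M : nat) (rho : 'I_M.+1 -> {poly F}).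

Lemma prod_subr_ffact n k :
  \prod_(i < k) (n%:R - i%:R) = (n ^_ k)%:R :> F.
Proof.
elim: k => [|k IHk]; first by rewrite big_ord0 ffactn0.
rewrite big_ord_recr /= IHk ffactnSr natrM.
have [le_kn|lt_nk] := leqP k n; first by rewrite natrB.
by rewrite ffact_small // !mul0r.
Qed.

(** A polynomial vanishing at all large integers is zero, hence so would be all
lambda_n; but if k is the least index with rho_{k,k} != 0, then
lambda_k = k! rho_{k,k}. *)
Lemma lambda_neq0_above m :
  exactly_solvable rho -> exists2 n, (m <= n)%N & lambda rho n != 0.
Proof.
case=> size_rho [k szk] _.
pose p := \sum_(k < M.+1) (rho k)`_k *: \prod_(i < k) ('X - (i%:R)%:P).
have p_lambda n : p.[n%:R] = lambda rho n.
  rewrite horner_sum; apply: eq_bigr => i _.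
  rewrite hornerZ horner_prod -prod_subr_ffact; congr (_ * _).
  by apply: eq_bigr => j _; rewrite hornerXsubC.
apply: contrapT => noroot.
have lam0 n : (m <= n)%N -> lambda rho n = 0.
  move=> le_mn; apply/eqP; apply: contrapT => /negP ?.
  by apply: noroot; exists n.
have p0 : p = 0.
  apply: (@roots_geq_poly_eq0 _ _ [seq i%:R | i <- iota m (size p)]).
  - apply/allP => _ /mapP[i + ->]; rewrite mem_iota => /andP[le_mi _].
    by rewrite /root p_lambda lam0.
  - by rewrite map_inj_uniq ?iota_uniq //; apply: mulrIn; rewrite oner_eq0.
  - by rewrite size_map size_iota.
have rk_neq0 : (rho k)`_k != 0.
  by rewrite -[k in _`_k]/(k.+1.-1) -szk lead_coef_eq0 -size_poly_eq0 szk.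
case: (@arg_minnP _ k (fun i : 'I_M.+1 => (rho i)`_i != 0)
  (fun i => i : nat)) => // j rj_neq0 j_min.
have : lambda rho j = (rho j)`_j * (j`!)%:R.
  rewrite /lambda (bigD1 j) //= ffactnn big1 ?addr0 // => i ne_ij.
  have [lt_ij|le_ji] := ltnP i j.
    have [->|/j_min] := eqVneq ((rho i)`_i) 0; first by rewrite mul0r.
    by rewrite leqNgt lt_ij.
  by rewrite ffact_small ?mulr0 // ltn_neqAle le_ji andbT eq_sym.
move/esym/eqP; rewrite -p_lambda p0 horner0 mulf_eq0 (negPf rj_neq0) pnatr_eq0.
by rewrite -leqn0 leqNgt fact_gt0.
Qed.

End EigenvaluePolynomial.

(** * Real polynomials integrated against the measure *)

Section PolynomialIntegral.
Variables (R : realType) (mu : {measure set (measurableTypeR R) -> \bar R}).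
Hypothesis mu_moments : finite_moments mu.

Local Notation Int p := (\int[mu]_x p.[x])%R.

Lemma integrable_horner (p : {poly R}) :
  mu.-integrable setT (EFin \o (fun x : measurableTypeR R => p.[x])).
Proof.
have -> : EFin \o (fun x : measurableTypeR R => p.[x]) =
    (fun x => \sum_(i < size p) ((p`_i)%:E * (x ^+ i)%:E))%E.
  apply/funext => x /=; rewrite horner_coef -sumEFin.
  by apply: eq_bigr => i _; rewrite EFinM.
apply: integrable_sum => // i _.
exact: (integrableZl _ _ (mu_moments i)).
Qed.

Lemma integral_hornerD (p q : {poly R}) : Int (p + q) = Int p + Int q.
Proof.
rewrite -RintegralD //; try exact: integrable_horner.
by apply: eq_Rintegral => x _; rewrite hornerD.
Qed.

Lemma integral_hornerZ a (p : {poly R}) : Int (a *: p) = a * Int p.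
Proof.
rewrite -RintegralZl //; last exact: integrable_horner.
by apply: eq_Rintegral => x _; rewrite hornerZ.
Qed.

Lemma integral_horner0 : Int 0 = 0.
Proof. by rewrite -(scale0r 0) integral_hornerZ mul0r. Qed.

Hypothesis mu_support : infinite_set (measure_support mu).

(** The set where p does not vanish is open and null, so it misses the support;
an infinite support would then give p infinitely many roots. *)
Lemma integral_horner_sqr_eq0 (p : {poly R}) : Int (p * p) = 0 -> p = 0.
Proof.
move=> Ipp0; apply/eqP; apply: contraT => p_neq0; exfalso; apply: mu_support.

have int_p2 := integrable_horner (p * p).

have int0 : (\int[mu]_x (EFin \o (fun x => (p * p).[x])) x)%E = 0%E.
  rewrite -[LHS]fineK ?(integrable_fin_num _ int_p2) //.
  by move: Ipp0; rewrite /Rintegral => ->.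
have int_abs0 : (\int[mu]_x `|(EFin \o (fun x => (p * p).[x])) x|)%E = 0%E.
  rewrite -int0; apply: eq_integral => x _ /=.
  by rewrite ger0_norm // hornerM -expr2 sqr_ge0.
have /(ae_eq_integral_abs _ measurableT (measurable_int _ int_p2)) ae0 :=
  int_abs0.
have open_nonroot : open [set x : R | p.[x] != 0].
  apply: (@open_comp _ _ (horner p) [set y | y != 0]); last exact: open_neq.
  by move=> x _; exact: continuous_horner.
have null_nonroot : mu [set x : R | p.[x] != 0] = 0%E.
  apply: measure_negligible; first exact: measurable_realfun.open_measurable.
  apply: negligibleS ae0 => x /= px_neq0 /(_ Logic.I) [].
  by apply/eqP; rewrite hornerM mulf_neq0.
have supp_root x : measure_support mu x -> root p x.
  move=> /(_ _ open_nonroot) /= pos; apply: contraT => /pos.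
  by rewrite null_nonroot ltxx.
have [B supp_B szB] := infinite_set_fset (size p) mu_support.
have B_roots : all (root p) B by apply/allP => x /supp_B /supp_root.
have := max_poly_roots p_neq0 B_roots (fset_uniq B).
by rewrite ltnNge szB.
Qed.


Variables (P : nat -> {poly R}) (P_OPS : monic_OPS mu P).

(** Since P_m is monic of degree m, polynomials of degree below n are
combinations of the P_m with m < n; the induction strips leading terms. *)
Lemma OPS_orthogonal n (r : {poly R}) : (size r <= n)%N -> Int (P n * r) = 0.
Proof.
have [P_monic P_orth] := P_OPS.
suff orth m : (m <= n)%N -> (size r <= m)%N -> Int (P n * r) = 0 by exact: orth.
elim: m r => [|m IHm] r le_mn szr.
  move: szr; rewrite size_poly_leq0 => /eqP->.
  by rewrite mulr0 integral_horner0.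
have [Pm_monic szPm] := P_monic m.
have szt : (size (r - r`_m *: P m)%R <= m)%N.
  apply/leq_sizeP => j; rewrite leq_eqVlt => /predU1P[<-|lt_mj].
    move/monicP: Pm_monic; rewrite /lead_coef szPm coefB coefZ => ->.
    by rewrite mulr1 subrr.
  rewrite coefB coefZ !(@nth_default _ _ _ j) ?mulr0 ?subrr ?szPm //.
  exact: leq_trans szr _.
rewrite -(subrK (r`_m *: P m) r) mulrDr integral_hornerD -scalerAr.
rewrite integral_hornerZ P_orth ?gtn_eqF // mulr0 addr0.
by apply: IHm => //; exact: ltnW.
Qed.

(** The difference a - a_n P_n has degree below n and is orthogonal to all such
polynomials, in particular to itself. *)
Lemma OPS_unique n (a : {poly R}) :
    (size a <= n.+1)%N ->
    (forall r : {poly R}, (size r <= n)%N -> Int (a * r) = 0) ->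
  a = a`_n *: P n.
Proof.
move=> sza a_orth; have [P_monic _] := P_OPS.
have [Pn_monic szPn] := P_monic n.
have szt : (size (a - a`_n *: P n)%R <= n)%N.
  apply/leq_sizeP => j; rewrite leq_eqVlt => /predU1P[<-|lt_nj].
    move/monicP: Pn_monic; rewrite /lead_coef szPn coefB coefZ => ->.
    by rewrite mulr1 subrr.
  rewrite coefB coefZ !(@nth_default _ _ _ j) ?mulr0 ?subrr ?szPn //.
  exact: leq_trans sza _.
apply/eqP; rewrite -subr_eq0; apply/eqP/integral_horner_sqr_eq0.
set t := a - _ in szt *.
rewrite {1}/t mulrBl -scalerAl -scaleNr integral_hornerD integral_hornerZ.
by rewrite a_orth // OPS_orthogonal // mulr0 addr0.
Qed.

End PolynomialIntegral.

(** * Orthogonality of complex polynomials *)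

Section ComplexOrthogonality.
Variable R : realType.
Local Notation toC := (map_poly (real_complex R)).

Lemma poly_complexE (T : {poly R[i]}) :
  T = toC (map_poly (@complex.Re R) T) + 'i *: toC (map_poly (@complex.Im R) T).
Proof.
apply/polyP => j; rewrite coefD coefZ !coef_map /=.
by rewrite -complexE.
Qed.

Lemma Cintegral_horner (mu : {measure set (measurableTypeR R) -> \bar R})
    (S q : {poly R[i]}) (a b : {poly R}) :
    S * q = toC a + 'i *: toC b ->
  Cintegral mu (fun x => S.[x%:C] * q.[x%:C]) =
  (\int[mu]_x a.[x])%R +i* (\int[mu]_x b.[x])%R.
Proof.
move=> Sq; rewrite /Cintegral.
have Sqx x : S.[x%:C] * q.[x%:C] = a.[x] +i* b.[x].
  rewrite -hornerM Sq hornerD hornerZ !horner_map /=; simpc.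
  by [].
by congr (_ +i* _); apply: eq_Rintegral => x _; rewrite Sqx.
Qed.

Variable mu : {measure set (measurableTypeR R) -> \bar R}.
Hypothesis mu_moments : finite_moments mu.
Hypothesis mu_support : infinite_set (measure_support mu).
Variables (P : nat -> {poly R}) (P_OPS : monic_OPS mu P).

(** Testing S against real polynomials separates its real and imaginary parts,
to which [OPS_unique] applies. *)
Lemma Cintegral_orthogonalP n (S : {poly R[i]}) :
    (size S <= n.+1)%N ->
  (forall q : {poly R[i]}, (size q <= n)%N ->
     Cintegral mu (fun x => S.[x%:C] * q.[x%:C]) = 0) <->
  S = S`_n *: toC (P n).
Proof.
move=> szS; split=> [S_orth|-> q szq]; last first.
  have Sq : (S`_n *: toC (P n)) * q =
      toC (P n * map_poly (@complex.Re R) (S`_n *: q)) +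
      'i *: toC (P n * map_poly (@complex.Im R) (S`_n *: q)).
    rewrite !rmorphM /= scalerAr -mulrDr -poly_complexE.
    by rewrite -scalerAl scalerAr.
  have sz_map (f : R[i] -> R) : (size (map_poly f (S`_n *: q)) <= n)%N.
    rewrite (leq_trans (size_poly _ _)) //.
    exact: leq_trans (size_scale_leq _ _) szq.
  by rewrite (Cintegral_horner _ Sq) !(OPS_orthogonal mu_moments P_OPS).
have sz_map (f : R[i] -> R) : (size (map_poly f S) <= n.+1)%N.
  exact: leq_trans (size_poly _ _) szS.
have part_orth (r : {poly R}) : (size r <= n)%N ->
    (\int[mu]_x (map_poly (@complex.Re R) S * r).[x])%R = 0 /\
    (\int[mu]_x (map_poly (@complex.Im R) S * r).[x])%R = 0.
  move=> szr; have := S_orth (toC r); rewrite size_map_poly => /(_ szr).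
  have Sr : S * toC r = toC (map_poly (@complex.Re R) S * r) +
                  'i *: toC (map_poly (@complex.Im R) S * r).
    by rewrite {1}[S]poly_complexE mulrDl -scalerAl !rmorphM.
  by rewrite (Cintegral_horner _ Sr) => -[-> ->].
have := OPS_unique mu_moments mu_support P_OPS (sz_map (@complex.Re R))
  (fun r szr => (part_orth r szr).1).
have := OPS_unique mu_moments mu_support P_OPS (sz_map (@complex.Im R))
  (fun r szr => (part_orth r szr).2).
rewrite !coef_map_id0 // => Im_eq Re_eq.
rewrite {1}[S]poly_complexE Re_eq Im_eq !map_polyZ /= scalerA -scalerDl.
by rewrite -complexE.
Qed.

(** Turns the orthogonality condition into an algebraic equation: the
coefficient of X^n in L Q is lambda_n because Q is monic. *)
Lemma diffop_orthogonalE (M : nat) (rho : 'I_M.+1 -> {poly R[i]}) n Q :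
    (forall k : 'I_M.+1, (size (rho k) <= k.+1)%N) ->
    Q \is monic -> size Q = n.+1 ->
  diffop_orthogonal rho mu n Q <-> diffop rho Q = lambda rho n *: toC (P n).
Proof.
move=> size_rho Q_monic szQ.
have szLQ : (size (diffop rho Q) <= n.+1)%N.
  by rewrite -szQ size_diffop.
have LQn : (diffop rho Q)`_n = lambda rho n.
  rewrite coef_diffop ?szQ //.
  by move/monicP: Q_monic; rewrite /lead_coef szQ => ->; rewrite mulr1.
have := Cintegral_orthogonalP szLQ; rewrite LQn => orthP.
by split=> [[_ /orthP]|/orthP] //; split; rewrite ?szQ.
Qed.

End ComplexOrthogonality.

(** * Characterization of the unique orthogonal sequence *)

Theorem theorem6 (R : realType)
    (mu : {finite_measure set (measurableTypeR R) -> \bar R})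
    (mu_moments : finite_moments mu)
    (mu_support : infinite_set (measure_support mu))
    (P : nat -> {poly R}) (P_OPS : monic_OPS mu P)
    (M : nat) (rho : 'I_M.+1 -> {poly R[i]})
    (rho_ES : exactly_solvable rho) :
  let unique_sequence :=
    exists! Q : nat -> {poly R[i]},
      forall n : nat,
        [/\ Q n \is monic, size (Q n) = n.+1 & diffop_orthogonal rho mu n (Q n)]
  in
  [/\ unique_sequence <-> (forall n : nat, size (diffop rho 'X^n) = n.+1),
      unique_sequence <->
        (forall n : nat, exists! Qh : {poly R[i]},
           Qh \is monic /\
           diffop rho Qh = lambda rho n *: map_poly (real_complex R) (P n)),
      unique_sequence <-> [set q : {poly R[i]} | diffop rho q = 0] = [set 0]
    & unique_sequence <-> (forall n : nat, lambda rho n != 0)].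
Proof.
set toC := map_poly _.
have [size_rho _ _] := rho_ES.
have orthE n Q := diffop_orthogonalE mu_moments mu_support P_OPS
  (n := n) (Q := Q) size_rho.
have [P_deg _] := P_OPS.
have toCP n : toC (P n) \is monic /\ size (toC (P n)) = n.+1.
  by have [? ?] := P_deg n; rewrite map_monic size_map_poly.
pose seqP (Q : nat -> {poly R[i]}) := forall n : nat,
  [/\ Q n \is monic, size (Q n) = n.+1 & diffop_orthogonal rho mu n (Q n)].
move=> unique_sequence.
have seq_iv : unique_sequence <-> (forall n, lambda rho n != 0).
  split=> [[Q [QP Q_uniq]] n|lam_neq0].
    apply/eqP => /(monic_kernel size_rho)[K K_monic LK0].
    (* The index n = size K is the first one with n > deg K, so that Q_n + K is
       another monic polynomial of degree n. *)
    have [Qm szQ Qo] := QP (size K).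
    have ltKQ : (size K < size (Q (size K)))%N by rewrite szQ.
    have [QKm szQK] := monic_perturb Qm K_monic ltKQ; apply.
    pose Q' j := if j == size K then Q (size K) + K else Q j.
    suff /Q_uniq eqQ : seqP Q'.
      by rewrite {2}eqQ /Q' eqxx.
    move=> j; rewrite /Q'; have [->|_] := eqVneq j (size K); last exact: QP.
    rewrite szQK; split=> //; apply/orthE; rewrite ?szQK //.
    by rewrite linearD /= LK0 addr0; apply/orthE.
  have sol n : exists q : {poly R[i]}, [/\ q \is monic, size q = n.+1 &
      diffop rho q = lambda rho n *: toC (P n)].
    by have [? ?] := toCP n; exact: monic_diffop_solution.
  have [Q QP] := choice sol.
  exists Q; split=> [n|Q' Q'P].
    by have [? ? ?] := QP n; split=> //; apply/orthE.
  apply/funext => n; have [_ _ LQ] := QP n; have [Q'm szQ' /orthE LQ'] := Q'P n.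
  apply/eqP; rewrite -subr_eq0; apply/eqP/(diffop_eq0 size_rho lam_neq0).
  by rewrite linearB /= LQ LQ' // subrr.
have i_iv : (forall n, size (diffop rho 'X^n) = n.+1) <->
    (forall n, lambda rho n != 0).
  split=> degs n; first by rewrite -size_diffopXn //; apply/eqP.
  by apply/eqP; rewrite size_diffopXn.
have ii_iv : (forall n : nat, exists! Qh : {poly R[i]}, Qh \is monic /\
      diffop rho Qh = lambda rho n *: toC (P n)) <->
    (forall n, lambda rho n != 0).
  split=> [ii n|lam_neq0 n].
    apply/eqP => /(monic_kernel size_rho)[K K_monic LK0].
    have [m le_Km lam_m] := lambda_neq0_above (size K) rho_ES.
    have [Q [[Qm LQ] Q_uniq]] := ii m.
    (* L does not raise degrees and L Q has degree m, so deg Q >= m > deg K. *)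
    have ltKQ : (size K < size Q)%N.
      apply: leq_ltn_trans le_Km _; have := size_diffop size_rho Q.
      by rewrite LQ size_scale // (toCP m).2.
    have [QKm _ neq] := monic_perturb Qm K_monic ltKQ; apply: neq.
    by apply/esym/Q_uniq; split=> //; rewrite linearD /= LK0 addr0.
  have [? ?] := toCP n.
  have [//|//|//|Q [Qm szQ LQ]] :=
    @monic_diffop_solution _ _ rho size_rho n (toC (P n)).
  exists Q; split=> // Q' [_ LQ'].
  apply/eqP; rewrite -subr_eq0; apply/eqP/(diffop_eq0 size_rho lam_neq0).
  by rewrite linearB /= LQ LQ' subrr.
have iii_iv : [set q : {poly R[i]} | diffop rho q = 0] = [set 0] <->
    (forall n, lambda rho n != 0).
  split=> [ker0 n|lam_neq0].
    apply/eqP => /(monic_kernel size_rho)[K K_monic LK0].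
    have : [set q : {poly R[i]} | diffop rho q = 0] K by [].
    rewrite ker0 /= => K0; move: K_monic.
    by rewrite K0 monicE lead_coef0 eq_sym oner_eq0.
  apply/seteqP; split=> q /=; first exact: diffop_eq0.
  by move=> ->; rewrite linear0.
by split; rewrite seq_iv ?i_iv ?ii_iv ?iii_iv.
Qed.
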